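(* Let $X$ and $Y$ be random variables with values in finite sets $\mathbb{X}$ and $\mathbb{Y}$, $|\mathbb{X}|>1$, $|\mathbb{Y}|>1$, with joint distribution $P_{X,Y}$ such that $P_X(x)>0$ for all $x\in\mathbb{X}$ and $P_Y(y)>0$ for all $y\in\mathbb{Y}$. Suppose that the posterior is strictly positive: $P_{Y\mid X}(y\mid x)>0$ for all $x\in\mathbb{X}$, $y\in\mathbb{Y}$. Let $Z=f_E(X)$ be the output of a (possibly randomized) feature map $f_E$, let $\gamma$ be a real number and let $\alpha\in\{1,\infty\}$. Then the following two properties cannot hold at the same time: 1. $Z=f_E(X)$ satisfies the least-privilege principle (LPP) with parameter $\gamma$; 2. $I_\alpha(Y;Z)>\gamma$.
   Context: All logarithms are base 2. A feature map $f_E$ from $\mathbb{X}$ to a finite set $\mathbb{Z}$ is given by a conditional distribution $P_{Z\mid X}$; the representation $Z=f_E(X)$ is drawn from $P_{Z\mid X}(\cdot\mid X)$ using randomness independent of $Y$ given $X$, so $Y - X - Z$ is a Markov chain. For random variables $A,B,C$, ''$A-B-C$ is a Markov chain'' means that $A$ and $C$ are conditionally independent given $B$. For a random variable $S$ with values in a finite set $\mathbb{S}$ and a random variable $W$ with values in a finite set $\mathbb{W}$, $\hat S(W)$ denotes the Bayes-optimal guess of $S$ from $W$, so $\Pr[S=\hat S(W)]=\max_{g:\mathbb{W}\to\mathbb{S}}\Pr[S=g(W)]$. $\hat S$ without argument denotes the majority guess, so $\Pr[S=\hat S]=\max_{s\in\mathbb{S}}\Pr[S=s]$. Utility: $I_1(Y;Z)$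 is Shannon's mutual information (in bits), and $I_\infty(Y;Z)=\log\frac{\Pr[Y=\hat Y(Z)]}{\Pr[Y=\hat Y]}$ (Arimoto's information of order $\infty$). LPP: given $P_{X,Y}$, the feature map $Z=f_E(X)$ satisfies the LPP with parameter $\gamma$ if, for every random variable (attribute) $S$ with values in a finite set (jointly distributed with $(X,Y,Z)$) such that $S-(X,Y)-Z$ is a Markov chain, $$\frac{\Pr[S=\hat S(Z,Y)]}{\Pr[S=\hat S(Y)]}\le 2^\gamma .$$ *)

(* Defs.v *)
From HB Require Import structures.
From mathcomp Require Import all_boot all_order all_algebra.
From mathcomp Require Import reals exp.

Set Implicit Arguments.
Unset Strict Implicit.
Unset Printing Implicit Defensive.

Import Order.TTheory GRing.Theory Num.Theory.

Local Open Scope ring_scope.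

Record fdist (R : realType) (T : finType) := FDist {
  pmf :> {ffun T -> R};
  pmf_ge0 : forall t, 0 <= pmf t;
  pmf_sum1 : \sum_t pmf t = 1 }.

(* Random variables on the finite probability space (T, P) are plain functions
   on T. *)
Definition Pr (R : realType) (T : finType) (P : fdist R T) (E : pred T) : R :=
  \sum_(t | E t) P t.

Definition cPr (R : realType) (T : finType) (P : fdist R T) (E F : pred T) : R :=
  Pr P (fun t => E t && F t) / Pr P F.

(* A - B - C: A and C are conditionally independent given B. *)
Definition markov_chain (R : realType) (T : finType) (P : fdist R T)
    (TA TB TC : finType) (A : T -> TA) (B : T -> TB) (C : T -> TC) : Prop :=
  forall a b c, 0 < Pr P (fun t => B t == b) ->
    cPr P (fun t => (A t == a) && (C t == c)) (fun t => B t == b) =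
    cPr P (fun t => A t == a) (fun t => B t == b) *
    cPr P (fun t => C t == c) (fun t => B t == b).

(* Pr[S = hat S].  The default value 0 of the iterated maximum is harmless:
   probabilities are nonnegative, and TS is inhabited since T is. *)
Definition guess_prob (R : realType) (T : finType) (P : fdist R T)
    (TS : finType) (S : T -> TS) : R :=
  \big[Num.max/0]_(s : TS) Pr P (fun t => S t == s).

(* Pr[S = hat S(W)] *)
Definition guess_prob_from (R : realType) (T : finType) (P : fdist R T)
    (TS TW : finType) (S : T -> TS) (W : T -> TW) : R :=
  \big[Num.max/0]_(g : {ffun TW -> TS}) Pr P (fun t => S t == g (W t)).

Definition log2 (R : realType) (x : R) : R := ln x / ln 2.

(* The convention 0 log 0 = 0 is automatic, log2 being total. *)
Definition shannon_info (R : realType) (T : finType) (P : fdist R T)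
    (TY TZ : finType) (Y : T -> TY) (Z : T -> TZ) : R :=
  \sum_(y : TY) \sum_(z : TZ)
    Pr P (fun t => (Y t == y) && (Z t == z)) *
    log2 (Pr P (fun t => (Y t == y) && (Z t == z)) /
          (Pr P (fun t => Y t == y) * Pr P (fun t => Z t == z))).

Definition arimoto_info_infty (R : realType) (T : finType) (P : fdist R T)
    (TY TZ : finType) (Y : T -> TY) (Z : T -> TZ) : R :=
  log2 (guess_prob_from P Y Z / guess_prob P Y).

Inductive info_order := order_one | order_infty.

Definition info (R : realType) (alpha : info_order) (T : finType)
    (P : fdist R T) (TY TZ : finType) (Y : T -> TY) (Z : T -> TZ) : R :=
  match alpha with
  | order_one => shannon_info P Y Z
  | order_infty => arimoto_info_infty P Y Z
  end.

Section Representation.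
Variables (R : realType) (TX TY TZ : finType).
Variables (PXY : fdist R (TX * TY)%type) (fE : TX -> fdist R TZ).

(* The law of (X, Y, Z) with Z drawn from fE X = P_{Z|X}( . | X) independently
   of Y given X. *)
Definition joint_pmf : {ffun TX * TY * TZ -> R} :=
  [ffun t => PXY t.1 * fE t.1.1 t.2].

Lemma joint_pmf_ge0 t : 0 <= joint_pmf t.
Proof. by rewrite ffunE mulr_ge0 ?pmf_ge0. Qed.

Lemma joint_pmf_sum1 : \sum_t joint_pmf t = 1.
Proof.
under eq_bigr do rewrite ffunE.
rewrite -(pair_bigA _ (fun u z => PXY u * fE u.1 z)) /= -[RHS](pmf_sum1 PXY).
by apply: eq_bigr => u _; rewrite -mulr_sumr pmf_sum1 mulr1.
Qed.

Definition joint : fdist R (TX * TY * TZ)%type :=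
  FDist joint_pmf_ge0 joint_pmf_sum1.

(* An attribute S jointly distributed with (X, Y, Z) is given by its finite
   range TS together with a law Q of ((X, Y, Z), S) whose (X, Y, Z)-marginal is
   [joint]; thus S may use randomness beyond (X, Y, Z). *)
Definition LPP (gamma : R) : Prop :=
  forall (TS : finType) (Q : fdist R (TX * TY * TZ * TS)%type),
    let XY := fun t : TX * TY * TZ * TS => t.1.1 in
    let Y := fun t : TX * TY * TZ * TS => t.1.1.2 in
    let Z := fun t : TX * TY * TZ * TS => t.1.2 in
    let S := fun t : TX * TY * TZ * TS => t.2 in
    (forall u, Pr Q (fun t => t.1 == u) = joint u) ->
    markov_chain Q S XY Z ->
    guess_prob_from Q S (fun t => (Z t, Y t)) / guess_prob_from Q S Y
      <= 2 `^ gamma.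

End Representation.

(* Main.v *)
(** The quantity [M = \sum_z max_x P(z|x)] (the exponential of the maximal
    leakage from X to Z) separates the two properties.  On the one hand,
    P(y,z) <= P(y) max_x P(z|x), whence I_oo(Y;Z) <= log M by summing over z
    and I_1(Y;Z) <= log M by Jensen's inequality.  On the other hand, positivity
    of the posterior makes m = min P(x,y) positive, and X can be shattered into
    an attribute S = (X, K) all of whose joint atoms with Y have mass at most m,
    exactly m when K = k0; then S is guessed from Y with probability |Y| m but
    from (Z, Y) with probability at least |Y| m M. *)
Require Import Defs.
From HB Require Import structures.
From mathcomp Require Import all_boot all_order all_algebra.
From mathcomp Require Import reals exp.
From mathcomp Require Import ring lra.

Import Order.TTheory GRing.Theory Num.Theory.
Local Open Scope ring_scope.

(** For [a <= 0] the default value [ln a = 0] is compared with [ln b], nonnegative since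
    [1 <= b]. *)
Lemma ler_ln_ge1 {R : realType} (a b : R) : a <= b -> 1 <= b -> ln a <= ln b.
Proof.
move=> ab b1; have b0 : 0 < b by apply: lt_le_trans b1.
have [a0|a0] := leP a 0; first by rewrite ln0 // ln_ge0.
by rewrite ler_ln ?posrE.
Qed.

Lemma ln_le_subr1 {R : realType} (a : R) : 0 < a -> ln a <= a - 1.
Proof.
by move=> a0; have := @le_ln1Dx R (a - 1); rewrite addrCA subrr addr0; apply; lra.
Qed.

Lemma ln2_gt0 {R : realType} : 0 < ln (2 : R).
Proof. by rewrite ln_gt0 // ltr1n. Qed.

Lemma log2_le {R : realType} (a b g : R) :
  a <= b -> 1 <= b -> b <= 2 `^ g -> log2 a <= g.
Proof.
move=> ab b1 bg; rewrite /log2 ler_pdivrMr ?ln2_gt0 // -ln_powR.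
by rewrite ler_ln_ge1 // ?(le_trans ab) // (le_trans b1).
Qed.

(** * Bounds on both informations from P(y,z) <= P(y) q(z) *)

Section Probability.
Context {R : realType} {T : finType} (P : fdist R T).

Lemma Pr_ge0 (E : pred T) : 0 <= Pr P E.
Proof. by apply: sumr_ge0 => t _; apply: pmf_ge0. Qed.

Lemma fdist_gt0 : exists t, 0 < P t.
Proof.
apply/existsP; apply: contraT; rewrite negb_exists => /forallP P0.
have /eqP := pmf_sum1 P; rewrite big1 => [|t _]; first by rewrite eq_sym oner_eq0.
by apply/eqP; rewrite eq_le pmf_ge0 leNgt P0.
Qed.

Lemma eq_Pr {E F : pred T} : E =1 F -> Pr P E = Pr P F.
Proof. by move=> EF; apply: eq_bigl. Qed.

Lemma Pr_partition {U : finType} (W : T -> U) (E : pred T) :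
  Pr P E = \sum_w Pr P (fun t => E t && (W t == w)).
Proof. exact: (partition_big W xpredT). Qed.

Lemma sum_Pr {U : finType} (W : T -> U) : \sum_w Pr P (fun t => W t == w) = 1.
Proof. by rewrite -(pmf_sum1 P) -(Pr_partition W xpredT). Qed.

Lemma Pr_and_le {E F : pred T} : Pr P (fun t => E t && F t) <= Pr P F.
Proof.
rewrite /Pr big_mkcond [leRHS]big_mkcond; apply: ler_sum => t _.
by case: (E t) => //=; case: (F t) => //; apply: pmf_ge0.
Qed.

Lemma Pr_le_guess_prob {TS : finType} (S : T -> TS) s :
  Pr P (fun t => S t == s) <= guess_prob P S.
Proof. exact: (le_bigmax 0 (fun s => Pr P (fun t => S t == s))). Qed.

Lemma Pr_le_guess_prob_from {TS TW : finType} (S : T -> TS) (W : T -> TW)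
    (g : {ffun TW -> TS}) :
  Pr P (fun t => S t == g (W t)) <= guess_prob_from P S W.
Proof.
exact: (le_bigmax 0 (fun g : {ffun TW -> TS} => Pr P (fun t => S t == g (W t)))).
Qed.

Context {TY TZ : finType} (Y : T -> TY) (Z : T -> TZ) (q : TZ -> R).
Hypothesis q_ge0 : forall z, 0 <= q z.
Hypothesis Prq : forall y z,
  Pr P (fun t => (Y t == y) && (Z t == z)) <= Pr P (fun t => Y t == y) * q z.

(** Split a correct guess by the value of [Z]: the slice at [z] is the event Y = g(z), Z = z, of
    mass at most Pr[Y = g(z)] q(z), and the first factor is at most [guess_prob P Y]. *)
Lemma guess_ratio_le : guess_prob_from P Y Z / guess_prob P Y <= \sum_z q z.
Proof.
have [t0 _] := fdist_gt0.
have G0 : 0 <= guess_prob P Y by apply: le_trans (Pr_ge0 _) (Pr_le_guess_prob Y (Y t0)).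
have [G0'|G_gt0] := leP (guess_prob P Y) 0.
  have -> : guess_prob P Y = 0 by apply/eqP; rewrite eq_le G0' G0.
  by rewrite invr0 mulr0 sumr_ge0.
rewrite ler_pdivrMr // mulr_suml; apply: bigmax_le => [|g _].
  by apply: sumr_ge0 => z _; rewrite mulr_ge0.
rewrite (Pr_partition Z); apply: ler_sum => z _.
rewrite (eq_Pr (F := fun t => (Y t == g z) && (Z t == z))); last first.
  by move=> t; rewrite /=; case: (Z t =P z) => [->|]; rewrite ?andbF.
by rewrite (le_trans (Prq _ _)) // mulrC ler_wpM2l // Pr_le_guess_prob.
Qed.

Lemma shannon_info_le : 0 < \sum_z q z -> shannon_info P Y Z <= log2 (\sum_z q z).
Proof.
set C := \sum_z q z => C0.
rewrite /shannon_info /log2 ler_pdivlMr ?ln2_gt0 // mulr_suml.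
pose p y z := Pr P (fun t => (Y t == y) && (Z t == z)).
pose pZ z := Pr P (fun t => Z t == z).
have pZE z : \sum_y p y z = pZ z.
  by rewrite /pZ (Pr_partition Y); apply: eq_bigr => y _; apply: eq_Pr => t; rewrite andbC.
(* Write the ratio as C a with a = p / (pY pZ C). Then p (a - 1) is at most the bracket, whose total
   is at most 1 - 1 = 0: summing over y turns its first term into q(z) / C, or into 0 where pZ
   vanishes. *)
apply: (@le_trans _ _
  (\sum_y \sum_z (p y z * ln C + (p y z * (q z / (pZ z * C)) - p y z)))).
  apply: ler_sum => y _; rewrite mulr_suml; apply: ler_sum => z _.
  rewrite mulrA mulfVK ?gt_eqF ?ln2_gt0 // -/(p y z) -/(pZ z).
  have [p0|p_gt0] := leP (p y z) 0.
    have -> : p y z = 0 by apply/eqP; rewrite eq_le p0 Pr_ge0.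
    by rewrite !mul0r subr0 addr0.
  have pZ0 : 0 < pZ z by apply: lt_le_trans p_gt0 Pr_and_le.
  set pY := Pr P _.
  have pY0 : 0 < pY.
    apply: lt_le_trans p_gt0 _.
    by rewrite /p (eq_Pr (F := fun t => (Z t == z) && (Y t == y))) ?Pr_and_le // => t; rewrite andbC.
  rewrite -[X in _ <= _ + (_ - X)]mulr1 -mulrBr -mulrDr ler_pM2l //.
  have -> : p y z / (pY * pZ z) = C * (p y z / (pY * pZ z * C)).
    by field; rewrite !gt_eqF.
  (* ln a <= a - 1 replaces Jensen's inequality. *)
  have a0 : 0 < p y z / (pY * pZ z * C) by rewrite divr_gt0 // !mulr_gt0.
  rewrite lnM ?posrE // lerD2l (le_trans (ln_le_subr1 _ a0)) // lerD2r.
  rewrite ler_pdivrMr ?mulr_gt0 //.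
  have -> : q z / (pZ z * C) * (pY * pZ z * C) = pY * q z.
    by field; rewrite !gt_eqF.
  exact: Prq.
rewrite exchange_big /=.
under eq_bigr do rewrite big_split /= big_split /= sumrN -!mulr_suml !pZE.
rewrite big_split /= big_split /= sumrN -mulr_suml sum_Pr mul1r.
rewrite gerDl subr_le0.
apply: (@le_trans _ _ (\sum_z q z / C)); last by rewrite -mulr_suml divff ?gt_eqF.
apply: ler_sum => z _; have [pZ0|pZ0] := leP (pZ z) 0.
  have -> : pZ z = 0 by apply/eqP; rewrite eq_le pZ0 Pr_ge0.
  by rewrite mul0r divr_ge0 // ltW.
suff -> : pZ z * (q z / (pZ z * C)) = q z / C by [].
by field; rewrite !gt_eqF.
Qed.

End Probability.

(** * Drawing a last coordinate from the first component of a pair *)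

Section Joint.
Context {R : realType} {A B C : finType}.
Context (P : fdist R (A * B)%type) (W : A -> fdist R C).

(** For each [u] only the value [h u] of the last coordinate survives. Correctness of a guessing
    rule [h] is an event of this form. *)
Lemma Pr_joint_graph (E : pred (A * B)%type) (h : A * B -> C) :
  Pr (joint P W) (fun t => (t.2 == h t.1) && E t.1) =
  \sum_(u | E u) P u * W u.1 (h u).
Proof.
under [RHS]eq_bigr => u _ do rewrite -(big_pred1_eq +%R (h u) (fun c => P u * W u.1 c)).
rewrite pair_big_dep /=; apply: eq_big => [[u c]|[u c] _]; first by rewrite andbC.
by rewrite /= ffunE.
Qed.

Lemma Pr_joint_fst (E : pred (A * B)%type) :
  Pr (joint P W) (fun t => E t.1) = Pr P E.
Proof.
rewrite /Pr; transitivity (\sum_(u | E u) \sum_c P u * W u.1 c).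
  rewrite pair_big_dep /=; apply: eq_big => [[u c]|[u c] _]; rewrite /= ?andbT //.
  by rewrite ffunE.
by apply: eq_bigr => u _; rewrite -mulr_sumr pmf_sum1 mulr1.
Qed.

Lemma joint_fstE u : Pr (joint P W) (fun t => t.1 == u) = P u.
Proof. by rewrite (Pr_joint_fst (pred1 u)) /Pr big_pred1_eq. Qed.

(** The last coordinate is drawn from [W a] alone. With [A] the range of (X, Y) and [B] that of Z,
    this is the condition S - (X, Y) - Z of the LPP. *)
Lemma markov_chain_joint :
  markov_chain (joint P W) (fun t => t.2) (fun t => t.1.1) (fun t => t.1.2).
Proof.
move=> c a b; rewrite /cPr => PA0.
set PA := Pr _ _ in PA0 *.
have -> : Pr (joint P W) (fun t => (t.2 == c) && (t.1.2 == b) && (t.1.1 == a)) =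
    P (a, b) * W a c.
  rewrite (eq_Pr _ (F := fun t => (t.2 == c) && (t.1 == (a, b)))).
    by rewrite (Pr_joint_graph (pred1 (a, b)) (fun=> c)) big_pred1_eq.
  by move=> [[a' b'] c'] /=; rewrite -andbA xpair_eqE [X in _ && X]andbC.
have -> : Pr (joint P W) (fun t => (t.2 == c) && (t.1.1 == a)) = PA * W a c.
  rewrite (Pr_joint_graph (fun u => u.1 == a) (fun=> c)) /PA.
  rewrite (Pr_joint_fst (fun u => u.1 == a)) /Pr mulr_suml.
  by apply: eq_bigr => u /eqP ->.
have -> : Pr (joint P W) (fun t => (t.1.2 == b) && (t.1.1 == a)) = P (a, b).
  rewrite -joint_fstE; apply: eq_Pr => -[[a' b'] c'] /=.
  by rewrite xpair_eqE andbC.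
by field; rewrite gt_eqF.
Qed.

End Joint.

Lemma shattering {R : realType} {A B : finType} (P : fdist R (A * B)%type) (m : R) :
  0 < m -> (forall u, m <= P u) ->
  exists (K : finType) (k0 : K) (W : A * B -> fdist R (A * K)%type),
    (forall u s, P u * W u s <= (s.1 == u.1)%:R * m) /\
    (forall u, P u * W u (u.1, k0) = m).
Proof.
move=> m0 mP; have P0 u : 0 < P u by apply: lt_le_trans (mP u).
(* The number of cells besides [k0]: it exceeds 1/m, so mass at most 1 split evenly leaves at most m
   per cell; the successor makes it visibly positive. *)
pose N := (Num.Def.archi_bound m^-1).+1.
have N0 : 0 < N%:R :> R by rewrite ltr0n.
have mN : 1 <= N%:R * m.
  rewrite -ler_pdivrMr // mul1r ltW // (@lt_trans _ _ (Num.Def.archi_bound m^-1)%:R) //.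
    by rewrite archi_boundP // invr_ge0 ltW.
  by rewrite ltr_nat.
have P1 u : P u <= 1.
  rewrite -(pmf_sum1 P) (bigD1 u) //= lerDl.
  by apply: sumr_ge0 => *; apply: pmf_ge0.
have mP1 u : m / P u <= 1 by rewrite ler_pdivrMr ?mul1r.
(* The first component copies X. Cell [ord0] gets conditional weight m / P(u), hence joint mass m;
   the [N] other cells share the rest equally. *)
pose w (u : A * B) : {ffun A * 'I_N.+1 -> R} := [ffun s => if s.1 == u.1 then
  if s.2 == ord0 then m / P u else (1 - m / P u) / N%:R else 0].
have w0 u s : 0 <= w u s.
  rewrite ffunE; case: ifP => // _; case: ifP => _.
    by rewrite divr_ge0 // ltW.
  by rewrite divr_ge0 ?subr_ge0 // ltW.
have w1 u : \sum_s w u s = 1.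
  under eq_bigr do rewrite ffunE.
  rewrite -(pair_bigA _ (fun a k => if a == u.1 then
    if k == ord0 then m / P u else (1 - m / P u) / N%:R else 0)) /=.
  rewrite (bigD1 u.1) //= [X in _ + X]big1 ?addr0 => [|a /negPf au]; last first.
    by rewrite big1 // => k _; rewrite au.
  rewrite eqxx big_ord_recl eqxx.
  rewrite (eq_bigr (fun=> (1 - m / P u) / N%:R)) //.
  rewrite sumr_const card_ord -(mulr_natr (_ / _)) mulfVK ?gt_eqF //.
  by rewrite addrCA subrr addr0.
exists 'I_N.+1, ord0, (fun u => FDist (w0 u) (w1 u)); split => [u s|u] /=.
  rewrite ffunE; case: eqP => [_|_]; last by rewrite mulr0 mul0r.
  rewrite mul1r; case: eqP => _; first by rewrite mulrC mulfVK ?gt_eqF.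
  have -> : P u * ((1 - m / P u) / N%:R) = (P u - m) / N%:R.
    by field; rewrite !gt_eqF.
  rewrite ler_pdivrMr // [m * _]mulrC; have := P1 u; lra.
by rewrite ffunE !eqxx mulrC mulfVK ?gt_eqF.
Qed.

(** * The LPP bounds M, and M bounds P(y,z) *)

Section Leakage.
Context {R : realType} {TX TY TZ : finType}.
Context (PXY : fdist R (TX * TY)%type) (fE : TX -> fdist R TZ).
Context (xmax : TZ -> TX).

(** [e y z] is a guess of X; its indicator keeps one x for each (y, z). *)
Lemma sum_joint_slice (m : R) (e : TY -> TZ -> TX) :
  \sum_(u : TX * TY * TZ) (e u.1.2 u.2 == u.1.1)%:R * m * fE u.1.1 u.2 =
  \sum_y \sum_z m * fE (e y z) z.
Proof.
rewrite -(pair_bigA _ (fun v z => (e v.2 z == v.1)%:R * m * fE v.1 z)) /=.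
rewrite -(pair_bigA _ (fun x y => \sum_z (e y z == x)%:R * m * fE x z)) /=.
rewrite exchange_big /=; apply: eq_bigr => y _.
rewrite exchange_big /=; apply: eq_bigr => z _.
rewrite (bigD1 (e y z)) //= eqxx mul1r big1 ?addr0 // => x /negPf.
by rewrite eq_sym => ->; rewrite !mul0r.
Qed.

Lemma LPP_leakage (gamma m : R) : 0 < m ->
  (forall u, m <= PXY u) -> LPP PXY fE gamma ->
  \sum_z fE (xmax z) z <= 2 `^ gamma.
Proof.
move=> m0 mP HL; have [[x0 y0] _] := fdist_gt0 PXY.
have [K [k0 [W [Wle Weq]]]] := shattering PXY m m0 mP.
set M := \sum_z _.
pose Q := joint (joint PXY fE) W.
have := HL _ Q (joint_fstE _ _) (markov_chain_joint _ _).
set num := guess_prob_from _ _ _; set den := guess_prob_from _ _ _ => HQ.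
pose n : R := #|TY|%:R.
have nm0 : 0 < n * m by rewrite mulr_gt0 // ltr0n; apply/card_gt0P; exists y0.
have guessE (h : TX * TY * TZ -> TX * K) : Pr Q (fun t => t.2 == h t.1) =
    \sum_u (PXY u.1 * W u.1 (h u)) * fE u.1.1 u.2.
  rewrite (eq_Pr _ (F := fun t => (t.2 == h t.1) && xpredT t.1)) => [|t]; last by rewrite andbT.
  rewrite (Pr_joint_graph (joint PXY fE) W xpredT h); apply: eq_bigr => u _.
  by rewrite ffunE mulrAC.
(* A guess from Y fixes an x that does not vary with z, so P(z|x) sums to 1 and each y contributes
   at most m. *)
have den_le : den <= n * m.
  apply: bigmax_le => [|g _]; first exact: ltW.
  rewrite (guessE (fun u => g u.1.2)).
  apply: (@le_trans _ _ (\sum_(u : TX * TY * TZ)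
     ((g u.1.2).1 == u.1.1)%:R * m * fE u.1.1 u.2)).
    by apply: ler_sum => u _; rewrite ler_wpM2r ?pmf_ge0.
  rewrite (sum_joint_slice m (fun y _ => (g y).1)).
  under eq_bigr do rewrite -mulr_sumr pmf_sum1 mulr1.
  by rewrite sumr_const -mulr_natl.
(* The guess is ([xmax z], [k0]): the likeliest x for z in the intended use, and the cell whose
   atoms have mass exactly m. *)
have num_ge : n * m * M <= num.
  apply: le_trans (Pr_le_guess_prob_from Q _ _ [ffun zy => (xmax zy.1, k0)]).
  rewrite (eq_Pr _ (F := fun t => t.2 == (xmax t.1.2, k0))); last by move=> t; rewrite ffunE.
  rewrite (guessE (fun u => (xmax u.2, k0))).
  have -> : n * m * M = \sum_(u : TX * TY * TZ)
     (xmax u.2 == u.1.1)%:R * m * fE u.1.1 u.2.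
    rewrite (sum_joint_slice m (fun _ => xmax)) sumr_const -mulr_sumr.
    by rewrite -mulrA mulr_natl.
  apply: ler_sum => u _; rewrite ler_wpM2r ?pmf_ge0 //.
  case: eqP => [->|_]; first by rewrite Weq mul1r.
  by rewrite mul0r mulr_ge0 ?pmf_ge0.
(* Clearing the fraction in [HQ] needs a positive denominator; the constant guess [(x0, k0)] already
   succeeds with probability at least |Y| m. *)
have den_gt0 : 0 < den.
  apply: lt_le_trans nm0 _.
  apply: le_trans (Pr_le_guess_prob_from Q _ _ [ffun=> (x0, k0)]).
  rewrite (eq_Pr _ (F := fun t => t.2 == (x0, k0))); last by move=> t; rewrite ffunE.
  rewrite (guessE (fun=> (x0, k0))).
  apply: (@le_trans _ _ (\sum_(u : TX * TY * TZ)
     (x0 == u.1.1)%:R * m * fE u.1.1 u.2)).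
    rewrite (sum_joint_slice m (fun _ _ => x0)).
    under eq_bigr do rewrite -mulr_sumr pmf_sum1 mulr1.
    by rewrite sumr_const -mulr_natl.
  apply: ler_sum => u _; rewrite ler_wpM2r ?pmf_ge0 //.
  case: eqP => [->|_]; first by rewrite Weq mul1r.
  by rewrite mul0r mulr_ge0 ?pmf_ge0.
rewrite -(ler_pM2l nm0) (le_trans num_ge) //.
rewrite ler_pdivrMr // in HQ; rewrite (le_trans HQ) // mulrC ler_wpM2r //.
exact: powR_ge0.
Qed.

Hypothesis fE_xmax : forall x z, fE x z <= fE (xmax z) z.

(** P(y,z) is the sum over x of P(x,y) P(z|x), and each P(z|x) is at most its maximum over x. *)
Lemma Pr_joint_le y z :
  Pr (joint PXY fE) (fun t => (t.1.2 == y) && (t.2 == z)) <=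
  Pr (joint PXY fE) (fun t => t.1.2 == y) * fE (xmax z) z.
Proof.
rewrite (eq_Pr _ (F := fun t => (t.2 == z) && (t.1.2 == y))); last first.
  by move=> t; rewrite andbC.
rewrite (Pr_joint_graph PXY fE (fun u => u.2 == y) (fun=> z)).
rewrite (Pr_joint_fst PXY fE (fun u => u.2 == y)) /Pr mulr_suml.
by apply: ler_sum => u _; rewrite ler_wpM2l ?pmf_ge0.
Qed.

End Leakage.

Theorem theorem2 (R : realType) (TX TY TZ : finType)
    (PXY : fdist R (TX * TY)%type) (fE : TX -> fdist R TZ)
    (gamma : R) (alpha : info_order)
    (cardX : (1 < #|TX|)%N) (cardY : (1 < #|TY|)%N)
    (PX_gt0 : forall x : TX, 0 < Pr PXY (fun t => t.1 == x))
    (PY_gt0 : forall y : TY, 0 < Pr PXY (fun t => t.2 == y))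
    (posterior_gt0 : forall (x : TX) (y : TY),
       0 < cPr PXY (fun t => t.2 == y) (fun t => t.1 == x)) :
  ~ (LPP PXY fE gamma /\
     gamma < info alpha (joint PXY fE) (fun t => t.1.2) (fun t => t.2)).
Proof.
(* The numerator of the posterior at (x, y) is the atom P(x,y) itself. *)
have P_gt0 u : 0 < PXY u.
  have := posterior_gt0 u.1 u.2; rewrite /cPr pmulr_lgt0 ?invr_gt0 //.
  rewrite (eq_Pr _ (F := pred1 u)); first by rewrite /Pr big_pred1_eq.
  by case: u => x y [x' y'] /=; rewrite xpair_eqE andbC.
have [x0 _] := card_gt0P (ltnW cardX); have [y0 _] := card_gt0P (ltnW cardY).
pose xmax z := [arg max_(x > x0) fE x z]%O.
have xmaxP x z : fE x z <= fE (xmax z) z.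
  by rewrite /xmax; case: arg_maxP => // x' _; apply.
pose umin := [arg min_(u < (x0, y0)) PXY u]%O.
have uminP u : PXY umin <= PXY u by rewrite /umin; case: arg_minP => // u' _; apply.
move=> [HL]; apply/negP; rewrite -leNgt.
have M_le := LPP_leakage PXY fE xmax _ _ (P_gt0 umin) uminP HL.
(* The maxima dominate the single row [fE x0], which sums to 1. *)
have M_ge1 : 1 <= \sum_z fE (xmax z) z.
  by rewrite -(pmf_sum1 (fE x0)); apply: ler_sum => z _.
have q_ge0 z : 0 <= fE (xmax z) z by apply: pmf_ge0.
have PrM := Pr_joint_le PXY fE xmax xmaxP.
case: alpha => /=.
  apply: le_trans (shannon_info_le _ _ _ _ q_ge0 PrM (lt_le_trans ltr01 M_ge1)) _.
  exact: log2_le (lexx _) M_ge1 M_le.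
exact: log2_le (guess_ratio_le _ _ _ _ q_ge0 PrM) M_ge1 M_le.
Qed.
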